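(* Let $n\ge 2$ and let $\mathbf p=(p_1,\dots,p_n)$ be a probability vector with $0<p_1\le p_2\le\dots\le p_n$. Let $C>\frac{(n-1)^2}{4p_1^2}$, let $\boldsymbol\delta^*$ be the Dirichlet mixture with parameter $C$ defined in the context, and let $S(\mathbf p,\boldsymbol\delta)=\gamma(\boldsymbol\delta-\mathbf p)$ with $\gamma=\frac{4C}{n}$. Then $\boldsymbol\delta=\boldsymbol\delta^*$ satisfies: (MC1) $E[S(\mathbf p,\boldsymbol\delta)]=\mathbf 0$; (MC2) $E[(\boldsymbol\delta-\mathbf p)S(\mathbf p,\boldsymbol\delta)']=\mathbf I-\lambda\mathbf 1\mathbf 1'$ for some $\lambda\in\mathbb R$; (MC3) with $\mu=0$: $E[(\boldsymbol\delta-\mathbf p)_i(\boldsymbol\delta-\mathbf p)_jS(\mathbf p,\boldsymbol\delta)_k]=0$ for all $i,j,k\in\{1,\dots,n\}$.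
   Context: $\mathbf 1$ is the all-ones vector, $\mathbf I$ the identity matrix, $\mathbf e_i$ the $i$-th standard basis vector of $\mathbb R^n$, $'$ denotes transpose. Dirichlet distributions with some zero parameters: for $\boldsymbol\alpha\in[0,\infty)^n\setminus\{0\}$, $\boldsymbol\delta\sim Dir(\boldsymbol\alpha)$ means that the coordinates with $\alpha_i=0$ are set to $0$ and the remaining coordinates follow the Dirichlet distribution with the corresponding positive parameters (so $Dir(\mathbf e_n)$ is the point mass at $\mathbf e_n$). Construction of $\boldsymbol\delta^*$. Define recursively $\theta^{l}=\frac{2p_l-\sum_{j=1}^{l-1}\theta^j}{n-l}$ for $l=1,\dots,n-1$ (so $\theta^1=\frac{2p_1}{n-1}$), and $\theta^n=p_n-\frac12\sum_{j=1}^{n-1}\theta^j$. Put $\theta^{l,i}=\theta^l$ for $1\le l\le n-1$, $l+1\le i\le n$. For these $(l,i)$ let $\boldsymbol\alpha^{l,i}=\alpha_0^{l,i}\cdot\frac12(\mathbf e_i+\mathbf e_l)$ with $\alpha_0^{l,i}=C(\theta^{l,i})^2-1$ (under the hypothesis on $C$ one has $C(\theta^{l,i})^2>1$ for all $l,i$), and let $\boldsymbol\alpha^n=\mathbf e_n$. Let $\boldsymbol\delta^{l,i}\sim Dir(\boldsymbol\alpha^{l,i})$ and $\boldsymbol\delta^n\sim Dir(\boldsymbol\alpha^n)$ be mutually independent and set $$\boldsymbol\delta^*=\sum_{l=1}^{n-1}\sum_{i=l+1}^n\theta^{l,i}\boldsymbol\delta^{l,i}+\theta^n\boldsymbol\delta^n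 .$$ *)

(* Defs.v *)
From HB Require Import structures.
From mathcomp Require Import all_boot all_order all_algebra.
From mathcomp Require Import all_classical all_reals all_analysis.

Set Implicit Arguments.
Unset Strict Implicit.
Unset Printing Implicit Defensive.

Import Order.TTheory GRing.Theory Num.Theory.
Import numFieldNormedType.Exports.

Local Open Scope classical_set_scope.
Local Open Scope ring_scope.

(* Random vectors take values in n.-tuple R, which
   the library equips with the product (Borel) sigma-algebra; linear algebra
   is done on the associated column vectors. *)
Definition colv (R : realType) (n : nat) (x : n.-tuple R) : 'cV[R]_n :=
  \col_i tnth x i.

Definition tuplev (R : realType) (n : nat) (v : 'cV[R]_n) : n.-tuple R :=
  [tuple v i 0 | i < n].

(* Mutual independence of the subfamily of X indexed by D. *)
Definition mutually_independent d (T : measurableType d) (R : realType)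
    (P : probability T R) d' (T' : measurableType d') (I : finType)
    (D : {set I}) (X : I -> {RV P >-> T'}) : Prop :=
  forall (J : {set I}) (B : I -> set T'),
    J \subset D -> (forall j, measurable (B j)) ->
    P (\bigcap_(j in [set` J]) (X j @^-1` B j)) =
    (\prod_(j in J) P (X j @^-1` B j))%E.

Definition set_coord (R : realType) (n : nat) (x : n.-tuple R) (i : 'I_n)
    (t : R) : n.-tuple R :=
  [tuple if j == i then t else tnth x j | j < n].

Fixpoint iter_integral (R : realType) (n : nat) (s : seq 'I_n)
    (f : n.-tuple R -> \bar R) (x : n.-tuple R) : \bar R :=
  if s is i :: s' then
    (\int[lebesgue_measure]_t iter_integral s' f (set_coord x i t))%E
  else f x.

(* Integral of f over the relatively open simplex
     { x | x_i > 0 for i in A, x_i = 0 for i notin A, \sum_i x_i = 1 }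
   with respect to Lebesgue measure in the coordinates indexed by A minus one
   pivot k, the k-th coordinate being 1 minus the sum of the others.  The
   choice of the pivot is immaterial: swapping it is an affine change of
   variables of Jacobian -1 or 1.  If A = [set k] no integration is left and
   the result is f (e_k). *)
Definition simplex_integral (R : realType) (n : nat) (A : {set 'I_n})
    (f : n.-tuple R -> \bar R) : \bar R :=
  if enum A is k :: s then
    iter_integral s (fun x =>
      let y := set_coord x k (1 - \sum_(j <- s) tnth x j) in
      if [forall i in A, 0 < tnth y i] then f y else 0%E)
      (nseq_tuple n 0)
  else 0%E.

Definition dirichlet_weight (R : realType) (n : nat) (alpha : 'cV[R]_n)
    (x : n.-tuple R) : R :=
  \prod_(i | 0 < alpha i 0) (tnth x i `^ (alpha i 0 - 1)).

(* Dirichlet law with parameter alpha >= 0, alpha != 0, as a set function on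
   R^n: the coordinates with alpha_i = 0 vanish and the others have the
   density  (1 / B(alpha)) \prod_i x_i^(alpha_i - 1)  on the simplex, where
   the multivariate beta function B(alpha) is the normalizing integral. *)
Definition dirichlet (R : realType) (n : nat) (alpha : 'cV[R]_n)
    (B : set (n.-tuple R)) : \bar R :=
  let A := [set i | 0 < alpha i 0]%SET in
  let beta := simplex_integral A (fun x => (dirichlet_weight alpha x)%:E) in
  ((fine beta)^-1%:E *
   simplex_integral A (fun x => (dirichlet_weight alpha x * \1_B x)%:E))%E.

Definition has_dirichlet_law d (T : measurableType d) (R : realType)
    (P : probability T R) (n : nat) (X : {RV P >-> n.-tuple R})
    (alpha : 'cV[R]_n) : Prop :=
  forall B : set (n.-tuple R), measurable B ->
    distribution P X B = dirichlet alpha B.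

Lemma dirichlet_point (R : realType) (n : nat) (k : 'I_n)
    (B : set (n.-tuple R)) :
  dirichlet (delta_mx k 0) B = \d_(tuplev (delta_mx k 0)) B.
Proof.
rewrite /dirichlet (_ : [set i | _]%SET = [set k]%SET); last first.
  apply/setP => i; rewrite !inE mxE eqxx andbT.
  by case: eqP => _; rewrite ?ltr01 ?ltxx.
rewrite /simplex_integral enum_set1 /= big_nil subr0.
set y := set_coord _ _ _.
have yE : y = tuplev (delta_mx k 0).
  apply: eq_from_tnth => i; rewrite !tnth_mktuple mxE eqxx andbT.
  by case: eqP => // _; rewrite (tnth_nth 0) nth_nseq if_same.
have yk : tnth y k = 1 by rewrite tnth_mktuple eqxx.
have -> : [forall i in [set k]%SET, 0 < tnth y i].
  by apply/forall_inP => i; rewrite inE => /eqP ->; rewrite yk ltr01.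
have -> : dirichlet_weight (delta_mx k 0) y = 1.
  rewrite /dirichlet_weight big1// => i; rewrite mxE eqxx andbT.
  by case: eqP => [->|_]; rewrite ?ltxx// subrr powRr0.
by rewrite /= invr1 mul1e mul1r diracE yE indicE.
Qed.

(* Dimension is written n.+1 and indices start at 0, so that theta p l is the
   (l+1)-st weight and the denominators "dimension minus (l+1)" are n - l.
   theta_seq p l lists the first l weights. *)
Fixpoint theta_seq (R : realType) (n : nat) (p : 'cV[R]_n.+1) (l : nat) :
    seq R :=
  if l is l'.+1 then
    let s := theta_seq p l' in
    rcons s ((2 * p (inord l') 0 - \sum_(x <- s) x) / (n - l')%:R)
  else [::].

Definition theta (R : realType) (n : nat) (p : 'cV[R]_n.+1) (l : nat) : R :=
  last 0 (theta_seq p l.+1).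

Definition theta_last (R : realType) (n : nat) (p : 'cV[R]_n.+1) : R :=
  p ord_max 0 - 2^-1 * \sum_(j < n) theta p j.

Lemma thetaE (R : realType) (n : nat) (p : 'cV[R]_n.+1) (l : nat) :
  theta p l = (2 * p (inord l) 0 - \sum_(j < l) theta p j) / (n - l)%:R.
Proof.
rewrite /theta /= last_rcons; congr ((_ - _) / _).
elim: l => [|l IHl]; first by rewrite big_nil big_ord0.
by rewrite big_ord_recr /= -IHl !last_rcons -cats1 big_cat /= big_seq1.
Qed.

Definition alpha_pair (R : realType) (n : nat) (C : R) (p : 'cV[R]_n.+1)
    (l i : 'I_n.+1) : 'cV[R]_n.+1 :=
  (C * theta p l ^+ 2 - 1) *: (2^-1 *: (delta_mx i 0 + delta_mx l 0)).

Definition alpha_last (R : realType) (n : nat) : 'cV[R]_n.+1 :=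
  delta_mx ord_max 0.

Definition components d (T : measurableType d) (R : realType)
    (P : probability T R) (n : nat)
    (delta : 'I_n.+1 -> 'I_n.+1 -> {RV P >-> n.+1.-tuple R})
    (delta_last : {RV P >-> n.+1.-tuple R})
    (o : option ('I_n.+1 * 'I_n.+1)) : {RV P >-> n.+1.-tuple R} :=
  if o is Some li then delta li.1 li.2 else delta_last.

Definition component_indices (n : nat) : {set option ('I_n.+1 * 'I_n.+1)} :=
  [set o : option ('I_n.+1 * 'I_n.+1) |
    if o is Some li then (li.1 < li.2)%N else true]%SET.

Definition delta_star d (T : measurableType d) (R : realType)
    (P : probability T R) (n : nat) (p : 'cV[R]_n.+1)
    (delta : 'I_n.+1 -> 'I_n.+1 -> {RV P >-> n.+1.-tuple R})
    (delta_last : {RV P >-> n.+1.-tuple R}) (w : T) : 'cV[R]_n.+1 :=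
  \sum_(l < n.+1) \sum_(i < n.+1 | (l < i)%N) theta p l *: colv (delta l i w)
  + theta_last p *: colv (delta_last w).

Definition score (R : realType) (n : nat) (gamma : R) (p x : 'cV[R]_n) :
    'cV[R]_n :=
  gamma *: (x - p).

(* Entries are kept in \bar R: for measurable X, an equality with a finite
   matrix (EFin_mx below) entails integrability of the entries. *)
Definition expectation_mx d (T : measurableType d) (R : realType)
    (P : probability T R) (m n : nat) (X : T -> 'M[R]_(m, n)) :
    'M[\bar R]_(m, n) :=
  \matrix_(i, j) 'E_P[fun w => X w i j]%E.

Definition EFin_mx (R : realType) (m n : nat) (A : 'M[R]_(m, n)) :
    'M[\bar R]_(m, n) := map_mx EFin A.

(* Main.v *)
Require Import Defs.
From HB Require Import structures.
From mathcomp Require Import all_boot all_order all_algebra.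
From mathcomp Require Import finmap ring lra.
From mathcomp Require Import all_classical all_reals all_analysis.
From mathcomp Require Import measurable_realfun.

(* For l < i the vector delta^{l,i} lies on the segment [e_l, e_i], and its i-th
   coordinate U follows the symmetric Beta(b, b) law with 2b + 1 = C theta_l^2.
   The recursion for theta says that the mixture has mean p, so almost surely
     delta^* - p = sum_{l < i} theta_l (U_{l,i} - 1/2) (e_i - e_l)
   with independent U_{l,i}.  Each U - 1/2 has first and third moments 0 and
   variance 1 / (4 C theta_l^2): hence all third moments of the sum vanish, and
   its covariance is 1/(4C) times the Laplacian of the complete graph, which is
   n I - 1 1'.  The Beta moments come from integrating the derivative of
   (1 - 2t)^k t^b (1 - t)^b over ]0, 1[. *)

Set Implicit Arguments.
Unset Strict Implicit.
Unset Printing Implicit Defensive.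

Import Order.TTheory GRing.Theory Num.Theory.
Import numFieldNormedType.Exports.

Local Open Scope classical_set_scope.
Local Open Scope ring_scope.

(** Two obstacles shape the proof. The Dirichlet law is given only as a set function built from
    iterated integrals, with no guarantee that its normalizing integral is finite; and independence
    is given only for events. One principle meets both: an identity between weighted integrals of
    indicators extends to nonnegative functions. It turns the law into a change of variables to ]0,
    1[, and independence into the vanishing of expected products.

    The constants fit together as follows. View [(l, i)] as an edge of the complete graph, of weight
    [theta p l]. Each end receives half of that weight in the mean, so the edges at vertex l must
    weigh 2 p_l in total; solving for theta_l gives the recursion, and [theta_last] completes the
    last vertex. The total parameter C theta_l^2 - 1 makes theta_l^2 times the Beta variance the
    same for all edges, so that the Laplacian appears unweighted. The bound on C says that this
    parameter is positive at the first weight, which is the smallest. *)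

Section eq_ge0_integral_weight.
Import HBSimple HBNNSimple.

(** Simple functions increasing to [h] and monotone convergence reduce [h] to indicators. Keeping
    the weights [V1], [V2] explicit avoids constructing measures with densities and their images. It
    serves with Lebesgue measure on one side, for the Dirichlet law, and with [P] on both sides, for
    independence. *)
Lemma eq_ge0_integral_weight d1 d2 d3 (T1 : measurableType d1)
    (T2 : measurableType d2) (S : measurableType d3) (R : realType)
    (mu1 : {measure set T1 -> \bar R}) (mu2 : {measure set T2 -> \bar R})
    (Y1 : T1 -> S) (Y2 : T2 -> S) (V1 : T1 -> R) (V2 : T2 -> R) (h : S -> R) :
  measurable_fun setT Y1 -> measurable_fun setT Y2 ->
  measurable_fun setT V1 -> measurable_fun setT V2 ->
  (forall x, 0 <= V1 x) -> (forall x, 0 <= V2 x) ->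
  (forall B, measurable B -> \int[mu1]_x (\1_B (Y1 x) * V1 x)%:E =
                             \int[mu2]_x (\1_B (Y2 x) * V2 x)%:E)%E ->
  measurable_fun setT h -> (forall s, 0 <= h s) ->
  (\int[mu1]_x (h (Y1 x) * V1 x)%:E = \int[mu2]_x (h (Y2 x) * V2 x)%:E)%E.
Proof.
move=> mY1 mY2 mV1 mV2 V1ge0 V2ge0 eqV mh hge0.
have mEh : measurable_fun [set: S] (EFin \o h : S -> \bar R).
  exact/measurable_EFinP.
pose hn := nnsfun_approx measurableT mEh.
have hnE d (T : measurableType d) (mu : {measure set T -> \bar R}) (Y : T -> S)
    (V : T -> R) : measurable_fun setT Y -> measurable_fun setT V ->
    (forall x, 0 <= V x) ->
    (\int[mu]_x (h (Y x) * V x)%:E =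
      limn (fun n => \int[mu]_x (hn n (Y x) * V x)%:E))%E.
  move=> mY mV Vge0.
  rewrite -monotone_convergence//.
  - apply: eq_integral => x _; apply/esym/cvg_lim => //=.
    have hge0E s : setT s -> (0 <= (EFin \o h) s)%E by rewrite lee_fin.
    have /= := cvg_nnsfun_approx measurableT mEh hge0E (I : setT (Y x)).
    move/fine_cvgP => [_ hcvg].
    by apply/cvg_EFin; [near=> n|apply: cvgMl; exact: hcvg].
  - move=> n; apply/measurable_EFinP; apply: measurable_funM => //.
    exact: measurableT_comp.
  - by move=> n x _; rewrite lee_fin mulr_ge0.
  - move=> x _ m n mn; rewrite lee_fin ler_wpM2r//.
    by have /lefP := nd_nnsfun_approx measurableT mEh mn; apply.
rewrite !hnE//; congr (limn _); apply/funext => n.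
pose s := fset_set (range (hn n)).
have sge0 (i : 'I_#|`s|) : 0 <= s`_i.
  have : s`_i \in s by rewrite mem_nth.
  by rewrite in_fset_set; [move=> /set_mem [x _ <-]|exact: fimfunP].
have mhn (i : 'I_#|`s|) : measurable (hn n @^-1` [set s`_i]).
  exact: measurable_sfunP.
have sumE d (T : measurableType d) (mu : {measure set T -> \bar R}) (Y : T -> S)
    (V : T -> R) : measurable_fun setT Y -> measurable_fun setT V ->
    (forall x, 0 <= V x) ->
    (\int[mu]_x (hn n (Y x) * V x)%:E =
     \sum_(i < #|`s|) (s`_i)%:E *
        \int[mu]_x (\1_(hn n @^-1` [set s`_i]) (Y x) * V x)%:E)%E.
  move=> mY mV Vge0.
  have mF (i : 'I_#|`s|) :
      measurable_fun setT (fun x => \1_(hn n @^-1` [set s`_i]) (Y x) * V x).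
    by apply: measurable_funM => //; apply: measurableT_comp.
  under eq_integral => x _.
    rewrite fimfunEord big_distrl/= -sumEFin.
    under eq_bigr do rewrite -mulrA EFinM.
    over.
  rewrite ge0_integral_sum//.
  - apply: eq_bigr => i _; rewrite ge0_integralZl_EFin//.
    + by move=> x _; rewrite lee_fin mulr_ge0.
    + exact/measurable_EFinP.
  - by move=> i; apply: measurable_funeM; exact/measurable_EFinP.
  - by move=> i x _; rewrite mule_ge0// lee_fin// mulr_ge0.
rewrite !sumE//; apply: eq_bigr => i _; congr (_ * _)%E; exact: eqV.
Unshelve. all: by end_near. Qed.

End eq_ge0_integral_weight.

(** * Bounded random variables and independence *)

Section bounded_random_variables.
Context d (T : measurableType d) (R : realType) (P : probability T R).
Implicit Types (X Y : T -> R).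

(** A bound at every point, not just almost everywhere, is stable under sums and products, so that
    every integrability condition below follows from the shape of the expression. *)
Definition bounded_measurable X :=
  measurable_fun setT X /\ exists M, forall w, `|X w| <= M.

Lemma bounded_measurable_cst (c : R) : bounded_measurable (fun=> c).
Proof. by split; [exact: measurable_cst|exists `|c|]. Qed.

Lemma bounded_measurableD X Y : bounded_measurable X ->
  bounded_measurable Y -> bounded_measurable (fun w => X w + Y w).
Proof.
move=> [mX [M XM]] [mY [N YN]]; split; first exact: measurable_funD.
by exists (M + N) => w; rewrite (le_trans (ler_normD _ _))// lerD.
Qed.

Lemma bounded_measurableM X Y : bounded_measurable X ->
  bounded_measurable Y -> bounded_measurable (fun w => X w * Y w).
Proof.
move=> [mX [M XM]] [mY [N YN]]; split; first exact: measurable_funM.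
by exists (M * N) => w; rewrite normrM ler_pM.
Qed.

Lemma bounded_measurable_sum (I : Type) (s : seq I) (Q : pred I)
    (F : I -> T -> R) : (forall i, Q i -> bounded_measurable (F i)) ->
  bounded_measurable (fun w => \sum_(i <- s | Q i) F i w).
Proof.
move=> bF; elim: s => [|i s IHs].
  by under eq_fun do rewrite big_nil; exact: bounded_measurable_cst.
under eq_fun do rewrite big_cons; case Qi: (Q i) => //.
by apply: bounded_measurableD => //; exact: bF.
Qed.

Lemma bounded_measurable_indic d' (S : measurableType d') (Z : T -> S) B :
  measurable_fun setT Z -> measurable B ->
  bounded_measurable (fun w => \1_B (Z w)).
Proof.
move=> mZ mB; split; first exact: measurableT_comp.
by exists 1 => w; rewrite indicE; case: (_ \in _); rewrite ?normr1// normr0.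
Qed.

Lemma bounded_measurable_integrable X : bounded_measurable X ->
  P.-integrable setT (EFin \o X).
Proof.
move=> [mX [M XM]]; apply: measurable_bounded_integrable => //.
  by rewrite -ge0_fin_numE// fin_num_measure.
exists M; split => [|N MN w _]; first exact: num_real.
exact: le_trans (XM w) (ltW MN).
Qed.

Lemma bounded_EFin_Rintegral X : bounded_measurable X ->
  (\int[P]_w (X w)%:E)%E = (\int[P]_w X w)%:E.
Proof.
move=> bX; rewrite /Rintegral fineK//.
exact/integrable_fin_num/bounded_measurable_integrable.
Qed.

Lemma bounded_RintegralD X Y : bounded_measurable X -> bounded_measurable Y ->
  \int[P]_w (X w + Y w) = \int[P]_w X w + \int[P]_w Y w.
Proof.
by move=> bX bY; rewrite RintegralD//; exact: bounded_measurable_integrable.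
Qed.

Lemma bounded_RintegralZl c X : bounded_measurable X ->
  \int[P]_w (c * X w) = c * \int[P]_w X w.
Proof.
by move=> bX; rewrite RintegralZl//; exact: bounded_measurable_integrable.
Qed.

Lemma bounded_Rintegral_sum (I : Type) (s : seq I) (Q : pred I)
    (F : I -> T -> R) : (forall i, Q i -> bounded_measurable (F i)) ->
  \int[P]_w (\sum_(i <- s | Q i) F i w) = \sum_(i <- s | Q i) \int[P]_w F i w.
Proof.
move=> bF; elim: s => [|i s IHs].
  by under eq_Rintegral do rewrite big_nil; rewrite big_nil Rintegral_cst// mul0r.
under eq_Rintegral do rewrite big_cons; rewrite big_cons -IHs; case Qi: (Q i) => //.
by rewrite bounded_RintegralD//; [exact: bF|exact: bounded_measurable_sum].
Qed.

Lemma Rintegral_probability_cst (c : R) : \int[P]_w c = c.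
Proof.
rewrite Rintegral_cst//; have /= -> := probability_setT P; exact: mulr1.
Qed.

(* V + M and the constant weight M give the same mass to every event of
   sigma(Y), hence the same integral to every function of Y. *)
Lemma bounded_orthogonal d' (S : measurableType d') (Y : T -> S) (V : T -> R)
    (h : S -> R) : measurable_fun setT Y -> bounded_measurable V ->
  measurable_fun setT h -> (exists N, forall s, `|h s| <= N) ->
  (forall B, measurable B -> \int[P]_w (\1_B (Y w) * V w) = 0) ->
  \int[P]_w (h (Y w) * V w) = 0.
Proof.
move=> mY bV mh [N hN] V0; have [mV [M VM]] := bV.
have bh : bounded_measurable (fun w => h (Y w)).
  by split; [exact: measurableT_comp|exists N => w; exact: hN].
have bc := bounded_measurable_cst.
have bD := bounded_measurableD; have bM := bounded_measurableM.
have intV : \int[P]_w V w = 0.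
  rewrite -(V0 setT)//; apply: eq_Rintegral => w _.
  by rewrite indicE in_setT mul1r.
have MX (X : T -> R) (bX : bounded_measurable X) :
    \int[P]_w (X w * (V w + M)) =
    \int[P]_w (X w * V w) + \int[P]_w (X w * M).
  under eq_Rintegral do rewrite mulrDr.
  by rewrite bounded_RintegralD//; exact: bM.
(* The shifts by [N] and [M] make both factors nonnegative. The terms in [M] then cancel between the
   two sides, and the term in [N] vanishes because [V] has integral 0. *)
have : (\int[P]_w ((h (Y w) + N) * (V w + M))%:E =
        \int[P]_w ((h (Y w) + N) * M)%:E)%E.
  apply: (@eq_ge0_integral_weight _ _ _ _ _ _ _ P P Y Y (fun w => V w + M)
    (fun=> M) (fun s => h s + N)) => //.
  - exact: measurable_funD.
  - by move=> w; rewrite -lerBlDr sub0r lerNl (le_trans _ (VM w))// -normrN ler_norm.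
  - by move=> w; rewrite (le_trans _ (VM w)).
  - move=> B mB; have bB := bounded_measurable_indic mY mB.
    rewrite !bounded_EFin_Rintegral ?MX ?V0 ?add0r//; [exact: bM|].
    by apply: bM => //; exact: bD.
  - exact: measurable_funD.
  - by move=> s; rewrite -lerBlDr sub0r lerNl (le_trans _ (hN s))// -normrN ler_norm.
rewrite !bounded_EFin_Rintegral; last 2 first.
- by apply: bM => //; exact: bD.
- by apply: bM; exact: bD.
case=> eqM; move: eqM; rewrite MX; last exact: bD.
move=> /eqP; rewrite -subr_eq0 addrK => /eqP.
under eq_Rintegral do rewrite mulrDl.
by rewrite bounded_RintegralD ?bounded_RintegralZl ?intV ?mulr0 ?addr0//; exact: bM.
Qed.

(* bounded_orthogonal turns the indicators of events into functions one variable
   at a time, starting from the weight 1_{X in A, Y in B} - P(X in A, Y in B). *)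
Lemma independent_Rintegral_eq0 d' (S : measurableType d') (X Y Z : T -> S)
    (f g h : S -> R) :
  measurable_fun setT X -> measurable_fun setT Y -> measurable_fun setT Z ->
  (forall A B C, measurable A -> measurable B -> measurable C ->
    P ((X @^-1` A `&` Y @^-1` B) `&` Z @^-1` C) =
    P (X @^-1` A `&` Y @^-1` B) * P (Z @^-1` C))%E ->
  measurable_fun setT f -> (exists M, forall s, `|f s| <= M) ->
  measurable_fun setT g -> (exists M, forall s, `|g s| <= M) ->
  measurable_fun setT h -> (exists M, forall s, `|h s| <= M) ->
  \int[P]_w h (Z w) = 0 ->
  \int[P]_w (f (X w) * g (Y w) * h (Z w)) = 0.
Proof.
move=> mX mY mZ indep mf bf mg bg mh bh h0.
have bcomp (W : T -> S) (k : S -> R) : measurable_fun setT W ->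
    measurable_fun setT k -> (exists M, forall s, `|k s| <= M) ->
    bounded_measurable (fun w => k (W w)).
  move=> mW mk [M kM]; split; first exact: measurableT_comp.
  by exists M => w; exact: kM.
have bc := bounded_measurable_cst.
have bD := bounded_measurableD; have bM := bounded_measurableM.
have bi := bounded_measurable_indic.
under eq_Rintegral do rewrite -mulrA.
apply: bounded_orthogonal => //.
  by apply: bM; exact: bcomp.
move=> A mA; under eq_Rintegral do rewrite mulrCA.
apply: bounded_orthogonal => //.
  by apply: bM; [exact: bi|exact: bcomp].
move=> B mB; under eq_Rintegral do rewrite mulrA mulrC.
have mXY : measurable (X @^-1` A `&` Y @^-1` B).
  by apply: measurableI; rewrite -[_ @^-1` _]setTI; [exact: mX|exact: mY].
pose p := fine (P (X @^-1` A `&` Y @^-1` B)).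
have bXY : bounded_measurable (fun w => \1_B (Y w) * \1_A (X w)).
  by apply: bM; exact: bi.
(* Subtracting the constant [p] costs nothing since [h (Z w)] has integral 0; by independence the
   centered weight is orthogonal to every event of [Z]. *)
suff : \int[P]_w (h (Z w) * (\1_B (Y w) * \1_A (X w) + - p)) = 0.
  under eq_Rintegral do rewrite mulrDr.
  rewrite bounded_RintegralD; [|exact/bM/bXY/bcomp|exact/bM/bc/bcomp].
  under [X in _ + X]eq_Rintegral do rewrite mulrC.
  rewrite bounded_RintegralZl; last exact: bcomp.
  by rewrite h0 mulr0 addr0.
apply: bounded_orthogonal => //; first exact: bD.
move=> C mC; under eq_Rintegral do rewrite mulrDr.
have bZ := bi _ _ _ _ mZ mC.
rewrite bounded_RintegralD; [|exact: bM|exact: bM].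
under [X in _ + X]eq_Rintegral do rewrite mulrC.
rewrite bounded_RintegralZl//.
have mZC : measurable (Z @^-1` C) by rewrite -[_ @^-1` _]setTI; exact: mZ.
have -> : \int[P]_w \1_C (Z w) = fine (P (Z @^-1` C)).
  rewrite /Rintegral; congr fine; rewrite -[X in _ = P X]setIT -integral_indic//.
have -> : \int[P]_w (\1_C (Z w) * (\1_B (Y w) * \1_A (X w))) =
    fine (P (X @^-1` A `&` Y @^-1` B `&` Z @^-1` C)).
  rewrite /Rintegral; congr fine; rewrite -[X in _ = P X]setIT.
  rewrite -integral_indic//; last exact: measurableI.
  apply: eq_integral => w _; congr EFin; rewrite !indicI/= !indicE.
  by rewrite mulrC; congr (_ * _); rewrite mulrC.
rewrite indep// fineM ?fin_num_measure//.
by rewrite /p mulNr subrr.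
Qed.

End bounded_random_variables.

(** * Moments of the symmetric Beta weight *)

Section beta_moments.
Context (R : realType).
Local Notation mu := (@lebesgue_measure R).

(** For b < 1 the Beta weight is unbounded near 0 and 1, so continuity of [f] can only be asked
    inside the interval. The usual theorem applies on each inner segment, and integrability of [f]
    carries the result to the endpoints. *)
Lemma Rintegral_FTC_oo (f F : R -> R) (a b A B : R) : a < b ->
  {in `]a, b[, forall x : R, is_derive x 1 F (f x)} ->
  {in `]a, b[, continuous f} ->
  mu.-integrable `[a, b] (EFin \o f) ->
  F x @[x --> a^'+] --> A -> F x @[x --> b^'-] --> B ->
  \int[mu]_(x in `[a, b]) f x = B - A.
Proof.
move=> ab dF cf intf FA FB.
pose G x := \int[mu]_(t in `[a, x]) f t.
have GF x y : a < x -> x < y -> y < b -> G y - G x = F y - F x.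
  move=> ax xy yb.
  have sub : `[x, y] `<=` `]a, b[.
    move=> z /=; rewrite !in_itv/= => /andP[xz zy].
    by rewrite (lt_le_trans ax xz) (le_lt_trans zy yb).
  have intay : mu.-integrable `[a, y] (EFin \o f).
    apply: integrableS intf => //.
    by apply: subset_itvl; rewrite bnd_simp ltW.
  have intxy : mu.-integrable `]x, y] (EFin \o f).
    apply: integrableS intay => //.
    by apply: subset_itvr; rewrite bnd_simp ltW.
  rewrite /G Rintegral_itvB//; [|by rewrite bnd_simp ltW|by rewrite bnd_simp ltW].
  rewrite Rintegral_itv_obnd_cbnd//.
  have cF z : z \in `]a, b[ -> {for z, continuous F}.
    move=> zab; apply: differentiable_continuous; apply/derivable1_diffP.
    by have [] := dF _ zab.
  rewrite /Rintegral (@continuous_FTC2 _ f F)//.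
  - apply: continuous_in_subspaceT => z /set_mem /sub zab; exact: cf.
  - split=> [z zxy||].
    + by have [] := dF z (sub _ (subset_itv_oo_cc zxy)).
    + by apply: cvg_at_right_filter; apply: cF; apply: sub; rewrite /= in_itv/= lexx ltW.
    + by apply: cvg_at_left_filter; apply: cF; apply: sub; rewrite /= in_itv/= lexx ltW.
  - move=> z zxy; rewrite derive1E.
    by have [_ ->] := dF z (sub _ (subset_itv_oo_cc zxy)).
(* [G - F] is constant inside the interval; its value at an interior point [m] is compared with its
   limits at both ends. *)
have [m am mb] : exists2 m, a < m & m < b.
  by exists ((a + b) / 2); lra.
have Ga : G x @[x --> a^'+] --> 0.
  exact: (cvg_at_right_filter (parameterized_integral_cvg_left ab intf)).
have Gb : G x @[x --> b^'-] --> G b.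
  exact: (parameterized_integral_cvg_at_left ab intf).
have {}Ga : A + (G m - F m) = 0.
  apply: (@cvg_unique _ _ (G x @[x --> a^'+])) => //.
  apply: cvg_trans (cvgD FA (cvg_cst (G m - F m))).
  apply: near_eq_cvg; near=> x.
  have := GF x m; rewrite !fctE => GFx.
  suff : G m - G x = F m - F x.
    by move=> GFe; rewrite addrC -(subrK (G x) (G m)) GFe; ring.
  apply: GFx; [by []|by []|exact: mb].
have {}Gb : B + (G m - F m) = G b.
  apply: (@cvg_unique _ _ (G x @[x --> b^'-])) => //.
  apply: cvg_trans (cvgD FB (cvg_cst (G m - F m))).
  apply: near_eq_cvg; near=> x.
  have := GF m x; rewrite !fctE => GFx.
  suff : G x - G m = F x - F m.
    by move=> GFe; rewrite -[RHS](subrK (G m)) GFe; ring.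
  apply: GFx; [exact: am|by []|by []].
have -> : \int[mu]_(x in `[a, b]) f x = G b by [].
by rewrite -Gb; lra.
Unshelve. all: by end_near. Qed.

(** The Beta(b, b) density up to normalization. The cutoff discards the values that [powR] takes
    outside ]0, 1[ and lets all integrals run over the whole line. *)
Definition beta_weight (b t : R) : R :=
  if 0 < t < 1 then t `^ (b - 1) * (1 - t) `^ (b - 1) else 0.

Lemma beta_weight_ge0 b t : 0 <= beta_weight b t.
Proof. by rewrite /beta_weight; case: ifP => // _; rewrite mulr_ge0 ?powR_ge0. Qed.

Lemma measurable_beta_weight b : measurable_fun setT (beta_weight b).
Proof.
apply: measurable_fun_if => //.
- by apply: measurable_and => //; exact: measurable_fun_ltr.
- apply: measurable_funTS; apply: measurable_funM.
    exact: measurable_powR.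
  have mB : measurable_fun setT (fun u : R => 1 - u) by apply: measurable_funB.
  exact: (measurableT_comp (measurable_powR (b - 1)) mB).
Qed.

Lemma cvg_onem_at_left1 : (1 - t : R) @[t --> (1 : R)^'-] --> (0 : R)^'+.
Proof.
move=> S [e e0 HS]; exists e => // t /= te t1; apply: HS => /=.
  rewrite sub0r normrN ger0_norm ?subr_ge0 1?ltW//.
  by move: te; rewrite ger0_norm// subr_ge0 ltW.
by rewrite subr_gt0.
Qed.

Let F b k (t : R) : R := (1 - 2 * t) ^+ k * (t `^ b * (1 - t) `^ b).

Let is_derive_onem_powR (b t : R) : t < 1 ->
  is_derive t 1 (fun u : R => (1 - u) `^ b) (- (b * (1 - t) `^ (b - 1))).
Proof.
move=> t1; have t10 : 0 < 1 - t by rewrite subr_gt0.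
have dB : is_derive t 1 (fun u : R => 1 - u) (0 - 1).
  exact: (is_deriveB (is_derive_cst (1 : R) t 1) (is_derive_id t (1 : R))).
have := @is_derive1_comp R (fun u => u `^ b) (fun u => 1 - u) t _ _
  (is_derive1_powR b t10) dB.
by rewrite sub0r mulrN1.
Qed.

(** With q = 1 - 2t one has t (1 - t) = (1 - q^2) / 4, so differentiating q^k yields only the powers
    k + 1 and k - 1 of q against the weight. For k = 0 the truncated [k.-1] is harmless, its
    coefficient being 0. *)
Let is_derive_F b k (t : R) : 0 < b -> t \in `]0, 1[ -> is_derive t 1 (F b k)
  ((b + k%:R / 2) * ((1 - 2 * t) ^+ k.+1 * beta_weight b t)
   - k%:R / 2 * ((1 - 2 * t) ^+ k.-1 * beta_weight b t)).
Proof.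
move=> b0; rewrite in_itv/= => /[dup] t01 /andP[t0 t1].
have t10 : 0 < 1 - t by rewrite subr_gt0.
have dpow : is_derive t 1 (fun u : R => u `^ b) (b * t `^ (b - 1)).
  exact: is_derive1_powR.
have d1pow := is_derive_onem_powR b t1.
have dlin : is_derive t 1 (fun u : R => 1 - 2 * u) (0 - 2 *: (1 : R)).
  exact: (is_deriveB (is_derive_cst (1 : R) t 1)
    (is_deriveZ 2 (is_derive_id t (1 : R)))).
have dq := @is_deriveX _ _ _ k _ _ _ dlin.
have -> : F b k = (fun u : R => 1 - 2 * u) ^+ k *
    ((fun u => u `^ b) * (fun u => (1 - u) `^ b)).
  by apply/funext => u; rewrite /F !fctE.
apply: is_derive_eq.
rewrite !fctE /beta_weight t01 /GRing.scale/=.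
set y := (1 - t) `^ (b - 1); set z := t `^ (b - 1).
have -> : t `^ b = t * z by rewrite mulr_powRB1// ltW.
have -> : (1 - t) `^ b = (1 - t) * y by rewrite mulr_powRB1// ltW.
case: k dq => [|k] _ /=; first by rewrite expr0 expr1; field.
by rewrite !exprS; field.
Qed.

Let continuous_qX k : continuous (fun t : R => (1 - 2 * t) ^+ k).
Proof.
move=> t; have ct : {for t, continuous (fun t : R => 1 - 2 * t)}.
  by apply: cvgB; [exact: cvg_cst|apply: cvgMr; exact: cvg_id].
exact: (continuous_comp ct (@exprn_continuous R k _)).
Qed.

Let continuous_powR b (t : R) : 0 < t ->
  {for t, continuous (fun u : R => u `^ b)}.
Proof.
move=> t0; apply: differentiable_continuous; apply/derivable1_diffP.
by have [] := is_derive1_powR b t0.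
Qed.

Let continuous_onem_powR b (t : R) : t < 1 ->
  {for t, continuous (fun u : R => (1 - u) `^ b)}.
Proof.
move=> t0; apply: differentiable_continuous; apply/derivable1_diffP.
by have [] := is_derive_onem_powR b t0.
Qed.

Let continuous_beta_weight b (t : R) : 0 < t < 1 ->
  {for t, continuous (beta_weight b)}.
Proof.
move=> /[dup] t01 /andP[t0 t1].
have : (fun u : R => u `^ (b - 1) * (1 - u) `^ (b - 1)) x @[x --> t] -->
    beta_weight b t.
  rewrite /beta_weight t01; apply: cvgM; first exact: continuous_powR.
  exact: continuous_onem_powR.
apply: cvg_trans; apply: near_eq_cvg; near=> u.
rewrite /beta_weight ifT//; apply/andP; split; near: u.
  exact: lt_nbhsr.
exact: lt_nbhsl.
Unshelve. all: by end_near. Qed.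

Let F_cvg0 b k : 0 < b -> F b k t @[t --> (0 : R)^'+] --> (0 : R).
Proof.
move=> b0; rewrite -[X in _ --> X](mulr0 ((1 - 2 * 0) ^+ k)).
apply: cvgM; first exact/cvg_at_right_filter/continuous_qX.
rewrite -[X in _ --> X](mul0r ((1 - 0) `^ b)).
apply: cvgM; first exact: powR_cvg0.
by apply/cvg_at_right_filter/continuous_onem_powR; exact: ltr01.
Qed.

Let F_cvg1 b k : 0 < b -> F b k t @[t --> (1 : R)^'-] --> (0 : R).
Proof.
move=> b0; rewrite -[X in _ --> X](mulr0 ((1 - 2 * 1) ^+ k)).
apply: cvgM; first exact/cvg_at_left_filter/continuous_qX.
rewrite -[X in _ --> X](mulr0 (1 `^ b)).
apply: cvgM.
  by apply/cvg_at_left_filter/continuous_powR; exact: ltr01.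
exact: (cvg_comp _ _ cvg_onem_at_left1 (powR_cvg0 b0)).
Qed.

(** Integrability of the weight stays a hypothesis throughout this part; it is later extracted from
    the existence of a random vector with the Dirichlet law. *)
Lemma beta_moment_integrable b k :
  mu.-integrable setT (EFin \o beta_weight b) ->
  mu.-integrable setT (fun t => ((1 - 2 * t) ^+ k * beta_weight b t)%:E).
Proof.
move=> intw; apply: le_integrable intw => //.
  apply/measurable_EFinP; apply: measurable_funM; last exact: measurable_beta_weight.
  by apply: measurable_funX; apply: measurable_funB => //; exact: mulrl_measurable.
move=> t _ /=; rewrite lee_fin normrM.
have [t01|t01] := boolP (0 < t < 1); last first.
  by rewrite /beta_weight (negbTE t01) normr0 mulr0.
rewrite ler_piMl// normrX exprn_ile1//.
by move/andP: t01 => [t0 t1]; rewrite ler_norml; apply/andP; split; lra.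
Qed.

(** Since b > 0, [F b k] tends to 0 at both endpoints and its derivative has integral 0. The cases k
    = 0, 1, 2 give the moments of order 1, 2, 3, the odd ones without the substitution of 1 - t for
    t. *)
Lemma beta_moment_rec b k : 0 < b ->
  mu.-integrable setT (EFin \o beta_weight b) ->
  (b + k%:R / 2) * \int[mu]_t ((1 - 2 * t) ^+ k.+1 * beta_weight b t) =
  k%:R / 2 * \int[mu]_t ((1 - 2 * t) ^+ k.-1 * beta_weight b t).
Proof.
move=> b0 intw.
have on01 j : \int[mu]_t ((1 - 2 * t) ^+ j * beta_weight b t) =
    \int[mu]_(t in `[0, 1]) ((1 - 2 * t) ^+ j * beta_weight b t).
  rewrite [RHS]Rintegral_mkcond; apply: eq_Rintegral => t _.
  rewrite patchE; case: ifPn => // /negP; rewrite inE/= in_itv/= => /negP t01.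
  rewrite /beta_weight ifF ?mulr0//; apply: contraNF t01 => /andP[t0 t1].
  by rewrite !ltW.
have int01 j : mu.-integrable `[0, 1]
    (fun t => ((1 - 2 * t) ^+ j * beta_weight b t)%:E).
  by apply: integrableS (beta_moment_integrable j intw).
rewrite !on01 -RintegralZl//; last exact: int01.
rewrite -RintegralZl//; last exact: int01.
apply/eqP; rewrite -subr_eq0 -RintegralB//=; last 2 first.
- exact: (integrableZl _ _ (int01 _)).
- exact: (integrableZl _ _ (int01 _)).
rewrite (@Rintegral_FTC_oo _ (F b k) 0 1 0 0) ?subrr//.
- by move=> t; exact: is_derive_F.
- move=> t; rewrite in_itv/= => t01.
  apply: cvgB; apply: cvgMr; apply: cvgM;
    by [exact: continuous_qX|exact: continuous_beta_weight].
- apply: (@integrableB _ _ _ mu _ _ (fun x => _%:E) (fun x => _%:E)) => //.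
  + exact: (integrableZl _ _ (int01 _)).
  + exact: (integrableZl _ _ (int01 _)).
- exact: F_cvg0.
- exact: F_cvg1.
Qed.

Lemma beta_moment1 b : 0 < b -> mu.-integrable setT (EFin \o beta_weight b) ->
  \int[mu]_t ((1 - 2 * t) ^+ 1 * beta_weight b t) = 0.
Proof.
move=> b0 intw; have := beta_moment_rec 0 b0 intw.
rewrite mul0r mul0r addr0 => /eqP; rewrite mulf_eq0 gt_eqF//= => /eqP; exact.
Qed.

Lemma beta_moment2 b : 0 < b -> mu.-integrable setT (EFin \o beta_weight b) ->
  \int[mu]_t ((1 - 2 * t) ^+ 2 * beta_weight b t) =
  (2 * b + 1)^-1 * \int[mu]_t beta_weight b t.
Proof.
move=> b0 intw; have /= := beta_moment_rec 1 b0 intw.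
under [in RHS]eq_Rintegral do rewrite expr0 mul1r.
set x := Rintegral _ _ _; set y := Rintegral _ _ _ => xy.
have -> : y = (2 * b + 1) * x by move: xy; lra.
by rewrite mulKf// gt_eqF//; lra.
Qed.

Lemma beta_moment3 b : 0 < b -> mu.-integrable setT (EFin \o beta_weight b) ->
  \int[mu]_t ((1 - 2 * t) ^+ 3 * beta_weight b t) = 0.
Proof.
move=> b0 intw; have /= := beta_moment_rec 2 b0 intw.
rewrite beta_moment1// mulr0 => /eqP; rewrite mulf_eq0 gt_eqF/=; last lra.
by move=> /eqP.
Qed.

End beta_moments.

(** * Bounded deviation from the midpoint *)

Section clipped_deviation.
Context (R : realType).

(* On the support ]0, 1[ of the Beta law this is t - 1/2; the value 0 elsewhere
   makes it bounded. *)
Definition clipped_dev (t : R) : R := if 0 < t < 1 then t - 2^-1 else 0.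

Lemma measurable_in01 : measurable_fun setT (fun t : R => 0 < t < 1).
Proof. by apply: measurable_and => //; exact: measurable_fun_ltr. Qed.

Lemma measurable_clipped_dev : measurable_fun setT clipped_dev.
Proof.
apply: measurable_fun_if => //; first exact: measurable_in01.
by apply: measurable_funTS; apply: measurable_funB.
Qed.

Lemma clipped_dev_le1 t : `|clipped_dev t| <= 1.
Proof.
rewrite /clipped_dev; case: ifP => [/andP[t0 t1]|_]; last by rewrite normr0.
by rewrite ler_norml; apply/andP; split; lra.
Qed.

End clipped_deviation.

(** * Dirichlet laws with two equal positive parameters *)

Section dirichlet_pair.
Context (R : realType) (n : nat) (l i : 'I_n).
Hypothesis li : (l < i)%N.
Local Notation mu := (@lebesgue_measure R).

Definition segment_point (t : R) : n.-tuple R :=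
  [tuple if k == l then 1 - t else if k == i then t else 0 | k < n].

(** The pivot of [simplex_integral] is the head of the enumeration: as l < i it is [l], and the i-th
    coordinate remains as the variable of integration. *)
Lemma enum_set2_ord : enum [set l; i]%SET = [:: l; i].
Proof.
apply: (@irr_sorted_eq _ (fun x y : 'I_n => (x < y)%N)).
- by move=> x y z; exact: ltn_trans.
- by move=> x; exact: ltnn.
- rewrite /enum_mem -enumT; apply: sorted_filter.
    by move=> x y z; exact: ltn_trans.
  by have := iota_ltn_sorted 0 n; rewrite -val_enum_ord sorted_map.
- by rewrite /= li.
- by move=> x; rewrite mem_enum !inE.
Qed.

Let neq_il : (i == l) = false.
Proof. by apply/negbTE; rewrite neq_ltn li orbT. Qed.

Lemma simplex_integral_pair (f : n.-tuple R -> \bar R) :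
  simplex_integral [set l; i]%SET f =
  (\int[mu]_t if (0 < t < 1)%R then f (segment_point t) else 0)%E.
Proof.
rewrite /simplex_integral enum_set2_ord /=; apply: eq_integral => t _.
set y := set_coord _ l _.
have -> : y = segment_point t.
  apply: eq_from_tnth => k; rewrite /y big_seq1 !tnth_mktuple eqxx.
  by case: eqP => // _; case: eqP => // _; rewrite (tnth_nth 0) nth_nseq if_same.
congr (if _ then _ else _); apply/forall_inP/andP => [y0|[t0 t1] k].
  have := y0 l; have := y0 i; rewrite !inE !eqxx !orbT !tnth_mktuple neq_il !eqxx.
  by rewrite subr_gt0 => /(_ isT) ? /(_ isT).
rewrite !inE tnth_mktuple => /orP[] /eqP ->; rewrite ?neq_il eqxx//.
by rewrite subr_gt0.
Qed.

Lemma measurable_segment_point : measurable_fun setT segment_point.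
Proof.
apply/measurable_fun_tnthP => k; rewrite (_ : _ \o _ = fun t =>
  if k == l then 1 - t else if k == i then t else 0); last first.
  by apply/funext => t /=; rewrite tnth_mktuple.
case: eqP => _; first exact: measurable_funB.
by case: eqP => _; [exact: measurable_id|exact: measurable_cst].
Qed.

Variables (alpha : 'cV[R]_n) (b : R).
Hypothesis b0 : 0 < b.
Hypothesis alphaE : forall k, alpha k 0 = if (k == l) || (k == i) then b else 0.

Lemma dirichlet_pairE (B : set (n.-tuple R)) : dirichlet alpha B =
  ((fine (\int[mu]_t (beta_weight b t)%:E))^-1%:E *
   \int[mu]_t (\1_B (segment_point t) * beta_weight b t)%:E)%E.
Proof.
have posE k : (0 < alpha k 0) = ((k == l) || (k == i)).
  by rewrite alphaE; case: ifP; rewrite ?b0 ?ltxx.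
have weightE t : dirichlet_weight alpha (segment_point t) =
    t `^ (b - 1) * (1 - t) `^ (b - 1).
  rewrite /dirichlet_weight (eq_bigl _ _ posE) (bigD1 l) ?eqxx//= mulrC.
  rewrite tnth_mktuple alphaE !eqxx; congr (_ * _).
  rewrite (big_pred1 i); last first.
    move=> k /=; case: (altP (k =P l)) => //= [->|_]; last by rewrite andbT.
    by rewrite eq_sym neq_il.
  by rewrite tnth_mktuple alphaE neq_il eqxx orbT.
rewrite /dirichlet (_ : [set k | _]%SET = [set l; i]%SET); last first.
  by apply/setP => k; rewrite !inE posE.
rewrite !simplex_integral_pair; congr ((fine _)^-1%:E * _)%E.
  by apply: eq_integral => t _; rewrite weightE /beta_weight; case: ifP.
apply: eq_integral => t _; rewrite weightE /beta_weight; case: ifP => // _.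
  by rewrite mulrC.
by rewrite mulr0.
Qed.

Context d (T : measurableType d) (P : probability T R).
Variable X : {RV P >-> n.-tuple R}.
Hypothesis lawX : has_dirichlet_law X alpha.

(* An infinite Beta integral would have fine value 0 and would make the law
   vanish, contradicting its total mass 1. *)
Lemma dirichlet_pair_integrable : mu.-integrable setT (EFin \o beta_weight b).
Proof.
have := lawX measurableT; rewrite dirichlet_pairE /distribution /pushforward.
have -> : P (X @^-1` setT) = 1%E by rewrite preimage_setT probability_setT.
under [X in (_ * X)%E]eq_integral do rewrite indicE in_setT mul1r.
move=> eq1; apply/integrableP; split.
  by apply/measurable_EFinP; exact: measurable_beta_weight.
under eq_integral do rewrite /= ger0_norm ?beta_weight_ge0//.
rewrite ltey; apply/eqP => intoo; move: eq1; rewrite intoo/= invr0 mul0e.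
by move=> /eqP; rewrite onee_eq0.
Qed.

(** As the inverse of 0 is 0, a zero normalizing constant would also give the law total mass 0. *)
Lemma dirichlet_pair_integral_gt0 : 0 < \int[mu]_t beta_weight b t.
Proof.
rewrite lt_neqAle Rintegral_ge0 ?andbT; last by move=> t _; exact: beta_weight_ge0.
apply/eqP => int0.
have := lawX measurableT; rewrite dirichlet_pairE /distribution /pushforward.
have -> : P (X @^-1` setT) = 1%E by rewrite preimage_setT probability_setT.
have -> : fine (\int[mu]_t (beta_weight b t)%:E)%E = 0 by rewrite int0.
by rewrite invr0 mul0e => /eqP; rewrite onee_eq0.
Qed.

(** The law of [X] is the image of the normalized Beta density under [segment_point]. The law
    hypothesis says so for indicators, and [eq_ge0_integral_weight] with weight 1 on the side of [P]
    extends it. *)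
Lemma dirichlet_pair_integral (h : n.-tuple R -> R) :
  measurable_fun setT h -> (forall x, 0 <= h x) ->
  (\int[P]_w (h (X w))%:E = \int[mu]_t
    (h (segment_point t) *
      ((\int[mu]_u beta_weight b u)^-1 * beta_weight b t))%:E)%E.
Proof.
move=> mh h0; have c0 := dirichlet_pair_integral_gt0.
set c := Rintegral _ _ _ in c0 *.
have mbeta := @measurable_beta_weight R b.
have mX : measurable_fun setT X by exact: measurable_funPT.
have mseg := measurable_segment_point.
under eq_integral do rewrite -(mulr1 (h _)).
apply: (@eq_ge0_integral_weight _ _ _ _ _ _ _ P mu X segment_point (cst 1)
  (fun t => c^-1 * beta_weight b t)) => //.
- by apply: measurable_funM.
- by move=> t; rewrite mulr_ge0 ?invr_ge0 ?(ltW c0)// beta_weight_ge0.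
- move=> B mB; under eq_integral do rewrite mulr1.
  have mXB : measurable (X @^-1` B) by rewrite -[_ @^-1` _]setTI; exact: mX.
  transitivity (P (X @^-1` B)).
    by rewrite -[in RHS](setIT (X @^-1` B)) -integral_indic.
  have := lawX mB; rewrite /distribution/pushforward => ->.
  rewrite dirichlet_pairE -/(Rintegral _ _ _) -/c -ge0_integralZl_EFin//.
  + by apply: eq_integral => t _; rewrite -EFinM mulrCA.
  + by move=> t _; rewrite lee_fin mulr_ge0// beta_weight_ge0.
  + apply/measurable_EFinP; apply: measurable_funM => //.
    exact: measurableT_comp.
  + by rewrite invr_ge0 ltW.
Qed.

Lemma bounded_clipped_devX k :
  bounded_measurable (fun w => clipped_dev (tnth (X w) i) ^+ k).
Proof.
split.
  apply: measurable_funX; apply: (measurableT_comp (@measurable_clipped_dev R)).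
  exact: (measurableT_comp (measurable_tnth i) (measurable_funPT X)).
by exists 1 => w; rewrite normrX exprn_ile1// clipped_dev_le1.
Qed.

Lemma dirichlet_pair_moment k :
  \int[P]_w clipped_dev (tnth (X w) i) ^+ k =
  (- 2^-1) ^+ k * ((\int[mu]_u beta_weight b u)^-1 *
    \int[mu]_t ((1 - 2 * t) ^+ k * beta_weight b t)).
Proof.
have c0 := dirichlet_pair_integral_gt0; have intw := dirichlet_pair_integrable.
(* The change of variables needs a nonnegative integrand: 1 is added to a power of absolute value at
   most 1, and cancels at the end because the normalized density has mass 1. *)
have mh : measurable_fun setT
    (fun x : n.-tuple R => clipped_dev (tnth x i) ^+ k + 1).
  apply: measurable_funD => //; apply: measurable_funX.
  exact: (measurableT_comp (@measurable_clipped_dev R) (measurable_tnth i)).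
have h0 (x : n.-tuple R) : 0 <= clipped_dev (tnth x i) ^+ k + 1.
  rewrite -lerBlDr sub0r.
  have : `|clipped_dev (tnth x i) ^+ k| <= 1.
    by rewrite normrX exprn_ile1// clipped_dev_le1.
  by rewrite ler_norml => /andP[].
set c := \int[mu]_u beta_weight b u in c0 *.
have : \int[P]_w (clipped_dev (tnth (X w) i) ^+ k + 1) =
    \int[mu]_t ((clipped_dev (tnth (segment_point t) i) ^+ k + 1) *
      (c^-1 * beta_weight b t)).
  by rewrite {1}/Rintegral (dirichlet_pair_integral mh h0).
rewrite bounded_RintegralD; last 2 first.
- exact: bounded_clipped_devX.
- exact: bounded_measurable_cst.
rewrite Rintegral_probability_cst.
have -> : \int[mu]_t ((clipped_dev (tnth (segment_point t) i) ^+ k + 1) *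
      (c^-1 * beta_weight b t)) =
    \int[mu]_t (((- 2^-1) ^+ k * c^-1) * ((1 - 2 * t) ^+ k * beta_weight b t) +
      c^-1 * beta_weight b t).
  apply: eq_Rintegral => t _; rewrite tnth_mktuple eqxx.
  rewrite neq_il /clipped_dev /beta_weight.
  case: ifP => _; last by rewrite !mulr0 addr0.
  rewrite (_ : t - 2^-1 = - 2^-1 * (1 - 2 * t)); last by field.
  by rewrite exprMn; ring.
have intq := beta_moment_integrable k intw.
rewrite RintegralD//; last 2 first.
- exact: (integrableZl _ _ intq).
- exact: (integrableZl _ _ intw).
rewrite !RintegralZl// -/c mulVf ?gt_eqF// => /addIr ->.
by rewrite mulrA.
Qed.

Lemma dirichlet_pair_moment1 : \int[P]_w clipped_dev (tnth (X w) i) = 0.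
Proof.
rewrite [LHS](dirichlet_pair_moment 1) beta_moment1//; first by rewrite !mulr0.
exact: dirichlet_pair_integrable.
Qed.

Lemma dirichlet_pair_moment2 :
  \int[P]_w clipped_dev (tnth (X w) i) ^+ 2 = (4 * (2 * b + 1))^-1.
Proof.
rewrite dirichlet_pair_moment beta_moment2//; last first.
  exact: dirichlet_pair_integrable.
have c0 := dirichlet_pair_integral_gt0.
set c := Rintegral _ _ _ in c0 *.
have b1 : 0 < 2 * b + 1 by rewrite addr_gt0// mulr_gt0.
by field; rewrite !gt_eqF.
Qed.

Lemma dirichlet_pair_moment3 :
  \int[P]_w clipped_dev (tnth (X w) i) ^+ 3 = 0.
Proof.
rewrite dirichlet_pair_moment beta_moment3//; first by rewrite !mulr0.
exact: dirichlet_pair_integrable.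
Qed.

Lemma dirichlet_pair_ae :
  {ae P, forall w, X w = segment_point (2^-1 + clipped_dev (tnth (X w) i))}.
Proof.
(* [h] is nonnegative and vanishes exactly on the open segment, so the support of the law can be
   read off the single integral of [h (X w)]. *)
pose h (x : n.-tuple R) : R := (if 0 < tnth x i < 1 then 0 else 1) +
  \sum_k `|tnth x k - tnth (segment_point (tnth x i)) k|.
have mi := @measurable_tnth _ R n.
have mh : measurable_fun setT h.
  apply: measurable_funD.
    apply: measurable_fun_if => //.
    exact: (measurableT_comp (@measurable_in01 R) (mi i)).
  apply: measurable_sum => k; apply: measurableT_comp => //.
  apply: measurable_funB => //; apply: (measurableT_comp (mi k)).
  by apply: measurableT_comp => //; exact: measurable_segment_point.
have h0 x : 0 <= h x by rewrite addr_ge0//; [case: ifP|exact: sumr_ge0].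
have := dirichlet_pair_integral mh h0.
rewrite [RHS]integral0_eq; last first.
  move=> t _; rewrite /beta_weight; case: ifP => t01; last by rewrite !mulr0.
  rewrite /h tnth_mktuple eqxx neq_il t01 add0r.
  by rewrite big1 ?mul0r// => k _; rewrite subrr normr0.
move=> int0.
have mhX : measurable_fun setT (fun w => (h (X w))%:E).
  by apply/measurable_EFinP; apply: measurableT_comp => //; exact: measurable_funPT.
have /(ae_eq_integral_abs P measurableT mhX) :
    (\int[P]_w `|(h (X w))%:E| = 0)%E.
  by under eq_integral do rewrite gee0_abs ?lee_fin//.
apply: filterS => w /(_ I)[/eqP].
rewrite /h paddr_eq0; [|by case: ifP|exact: sumr_ge0].
case: ifP => [t01 /= sum0|_]; last by rewrite oner_eq0.
rewrite /clipped_dev t01 addrC subrK; apply: eq_from_tnth => k.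
move: sum0; rewrite eqxx psumr_eq0 => [/allP/(_ k)|//].
by rewrite mem_index_enum normr_eq0 subr_eq0 => /(_ isT)/eqP.
Qed.

End dirichlet_pair.

(** * The weights theta and the complete graph *)

Section theta.
Context (R : realType) (n : nat) (p : 'cV[R]_n.+1).

(** The left side is the total weight of the edges at vertex [l]: [n - l] edges to larger vertices,
    all of weight [theta p l], and one of weight [theta p j] to each smaller [j]. *)
Lemma theta_sum (l : 'I_n.+1) : (l < n)%N ->
  (n - l)%:R * theta p l + \sum_(j < l) theta p j = 2 * p l 0.
Proof.
move=> ln; rewrite thetaE inord_val mulrC divfK ?subrK//.
by rewrite pnatr_eq0 -lt0n subn_gt0.
Qed.

Hypothesis p_gt0 : 0 < p ord0 0.
Hypothesis p_mono : forall i j : 'I_n.+1, (i <= j)%N -> p i 0 <= p j 0.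

(** Subtracting [theta_sum] at l from [theta_sum] at l + 1 gives (n - l - 1) (theta_{l+1} - theta_l)
    = 2 (p_{l+1} - p_l), so theta increases with p. *)
Lemma theta_ge l : (l < n)%N -> theta p 0 <= theta p l.
Proof.
elim: l => // l IHl ln.
have ln1 : (l < n.+1)%N by rewrite ltnW// ltnW.
have sln1 : (l.+1 < n.+1)%N by rewrite ltnW.
have := @theta_sum (Ordinal ln1) (ltnW ln); have := @theta_sum (Ordinal sln1) ln.
have := p_mono (leqnSn l : (Ordinal ln1 <= Ordinal sln1)%N).
rewrite /= big_ord_recr /=.
have -> : (n - l)%:R = (n - l.+1)%:R + 1 :> R by rewrite natr1 subnSK// ltnW.
set N := (n - l.+1)%:R; set s := \sum_(_ < _) _ => pl eq1 eq2.
apply: le_trans (IHl (ltnW ln)) _.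
have N0 : 0 < N by rewrite ltr0n subn_gt0.
rewrite -(ler_pM2l N0).
lra.
Qed.

Lemma theta_gt0 l : (l < n)%N -> 0 < theta p l.
Proof.
move=> ln; apply: lt_le_trans (theta_ge ln).
rewrite thetaE big_ord0 subr0 subn0 (_ : inord 0 = ord0).
  by rewrite divr_gt0 ?mulr_gt0// ltr0n (leq_trans _ ln).
by apply: val_inj; rewrite /= inordK.
Qed.

(** For l = 0 this is the bound on [C] rewritten, as theta_0 = 2 p_0 / n; the other weights are at
    least theta_0. *)
Lemma theta_sqr_gt C l : n%:R ^+ 2 / (4 * p ord0 0 ^+ 2) < C -> (l < n)%N ->
  1 < C * theta p l ^+ 2.
Proof.
move=> hC ln.
have n0 : (0 : R) < n%:R by rewrite ltr0n (leq_trans _ ln).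
have p2 : 0 < p ord0 0 ^+ 2 by rewrite exprn_gt0.
have C0 : 0 < C by rewrite (lt_trans _ hC)// divr_gt0// ?exprn_gt0// mulr_gt0.
have t0 : theta p 0 = 2 * p ord0 0 / n%:R.
  rewrite thetaE big_ord0 subr0 subn0; congr (2 * p _ _ / _).
  by apply: val_inj; rewrite /= inordK.
apply: (@lt_le_trans _ _ (C * theta p 0 ^+ 2)).
  rewrite t0 -(ltr_pdivrMr _ _ _)//; last by rewrite exprn_gt0// divr_gt0// mulr_gt0.
  rewrite (_ : 1 / _ = n%:R ^+ 2 / (4 * p ord0 0 ^+ 2))//.
  by field; rewrite !gt_eqF.
rewrite ler_wpM2l ?(ltW C0)// ler_sqr ?nnegrE ?theta_ge//.
  by rewrite ltW// theta_gt0// (leq_trans _ ln).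
by rewrite ltW// theta_gt0.
Qed.

Lemma mixture_mean (k : 'I_n.+1) :
  \sum_(l < n.+1) \sum_(i < n.+1 | (l < i)%N)
     theta p l * (2^-1 * ((k == i)%:R + (k == l)%:R)) +
  theta_last p * (k == ord_max)%:R = p k 0.
Proof.
have sum_l : \sum_(l < n.+1) \sum_(i < n.+1 | (l < i)%N) theta p l * (k == l)%:R =
    (n - k)%:R * theta p k.
  rewrite (bigD1 k)//= [X in _ + X]big1 ?addr0; last first.
    by move=> l /negbTE lk; rewrite big1// => i _; rewrite eq_sym lk mulr0.
  rewrite sumr_const eqxx mulr1 mulr_natl; congr (_ *+ _).
  rewrite -sum1_card (eq_bigl (fun i : 'I_n.+1 => (k < i)%N))//.
  rewrite -(big_mkord (fun i => (k < i)%N) (fun=> 1%N)).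
  rewrite (big_cat_nat _ (n := k.+1))//= big_nat_cond big1 ?add0n; last first.
    by move=> i /andP[]; rewrite ltnS => /andP[_]; rewrite leqNgt => /negbTE ->.
  rewrite big_nat_cond (eq_bigl (fun i => (k.+1 <= i < n.+1)%N)); last first.
    by move=> i; case: (ltnP k i) => //=; rewrite andbT.
  by rewrite -big_nat sum_nat_const_nat muln1 subSS.
have sum_i : \sum_(l < n.+1) \sum_(i < n.+1 | (l < i)%N) theta p l * (k == i)%:R =
    \sum_(j < k) theta p j.
  transitivity (\sum_(l < n.+1 | (l < k)%N) theta p l).
    rewrite [RHS]big_mkcond; apply: eq_bigr => l _; case: ifPn => lk.
      rewrite (bigD1 k)//= eqxx mulr1 big1 ?addr0// => i /andP[_ /negbTE ik].
      by rewrite eq_sym ik mulr0.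
    rewrite big1// => i li; case: eqP => [ki|_]; last by rewrite mulr0.
    by move: lk; rewrite ki li.
  by rewrite [RHS](big_ord_widen_cond n.+1 xpredT (theta p)) // ltnW.
have -> : \sum_(l < n.+1) \sum_(i < n.+1 | (l < i)%N)
     theta p l * (2^-1 * ((k == i)%:R + (k == l)%:R)) =
   2^-1 * ((n - k)%:R * theta p k + \sum_(j < k) theta p j).
  rewrite -sum_l -sum_i -big_split/= mulr_sumr; apply: eq_bigr => l _.
  rewrite -big_split/= mulr_sumr; apply: eq_bigr => i _; ring.
(* No edge starts at [ord_max]: the factor [(n - k)%:R] is 0 there and removes [theta p n], whose
   quotient has denominator 0. What is missing from [p ord_max 0] is [theta_last p] by
   definition. *)
have [->|kmax] := eqVneq k ord_max.
  by rewrite subnn mul0r add0r mulr1 /theta_last addrC subrK.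
rewrite mulr0 addr0 theta_sum ?mulKf//.
by rewrite ltn_neqAle -ltnS ltn_ord andbT.
Qed.

(** The summand is the (j, k) entry of (e_i - e_l)(e_i - e_l)'. It is symmetric in l and i and zero
    for l = i, so twice the sum is the unrestricted double sum, which expands into Kronecker
    deltas. *)
Lemma sum_pair_graph_laplacian (j k : 'I_n.+1) :
  \sum_(l < n.+1) \sum_(i < n.+1 | (l < i)%N)
    ((j == i)%:R - (j == l)%:R) * ((k == i)%:R - (k == l)%:R) =
  n.+1%:R * (j == k)%:R - 1 :> R.
Proof.
pose s (l i : 'I_n.+1) : R :=
  ((j == i)%:R - (j == l)%:R) * ((k == i)%:R - (k == l)%:R).
have double : 2 * (\sum_(l < n.+1) \sum_(i < n.+1 | (l < i)%N) s l i) =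
    \sum_(l < n.+1) \sum_(i < n.+1) s l i.
  rewrite mulr_natl mulr2n.
  rewrite [X in _ + X](exchange_big_dep xpredT)//= -big_split/=.
  apply: eq_bigr => l _; rewrite big_mkcond [X in _ + X]big_mkcond -big_split/=.
  apply: eq_bigr => i _; case: ltngtP => [_|_|li]; rewrite ?addr0 ?add0r//.
    by rewrite /s; ring.
  by rewrite /s (val_inj li) !subrr mulr0.
have sum_delta (a : 'I_n.+1) : \sum_(i < n.+1) (a == i)%:R = 1 :> R.
  rewrite (bigD1 a)//= eqxx big1 ?addr0// => i /negbTE ai.
  by rewrite eq_sym ai.
have sum_delta2 : \sum_(i < n.+1) (j == i)%:R * (k == i)%:R = (j == k)%:R :> R.
  rewrite (bigD1 j)//= eqxx mul1r big1 ?addr0 => [|i /negbTE ji].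
    by rewrite eq_sym.
  by rewrite [j == i]eq_sym ji mul0r.
have : \sum_(l < n.+1) \sum_(i < n.+1) s l i =
    2 * (n.+1%:R * (j == k)%:R - 1) :> R.
  transitivity (\sum_(l < n.+1) ((j == k)%:R + n.+1%:R * ((j == l)%:R * (k == l)%:R)
      - (j == l)%:R - (k == l)%:R) : R).
    apply: eq_bigr => l _.
    transitivity (\sum_(i < n.+1) ((j == i)%:R * (k == i)%:R + (j == l)%:R * (k == l)%:R
      - (k == l)%:R * (j == i)%:R - (j == l)%:R * (k == i)%:R) : R).
      by apply: eq_bigr => i _; rewrite /s; ring.
    rewrite !sumrB big_split/= sum_delta2 sumr_const card_ord -!mulr_sumr !sum_delta.
    by rewrite -[in X in X - _ - _]mulr_natl; ring.
  rewrite !sumrB big_split/= sumr_const card_ord -mulr_sumr sum_delta2 !sum_delta.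
  by rewrite -[in X in X - _ - _]mulr_natl; ring.
rewrite -double => /mulfI; apply; by rewrite pnatr_eq0.
Qed.

End theta.

(** * Moments of the mixture *)

Section dirichlet_mixture.
Context (R : realType) (d : measure_display) (T : measurableType d)
  (P : probability T R) (n : nat) (p : 'cV[R]_n.+1).
Hypotheses (p_gt0 : 0 < p ord0 0)
  (p_mono : forall i j : 'I_n.+1, (i <= j)%N -> p i 0 <= p j 0).
Variable C : R.
Hypothesis C_gt : n%:R ^+ 2 / (4 * p ord0 0 ^+ 2) < C.
Variables (delta : 'I_n.+1 -> 'I_n.+1 -> {RV P >-> n.+1.-tuple R})
  (delta_last : {RV P >-> n.+1.-tuple R}).
Hypotheses
  (law_delta : forall l i : 'I_n.+1, (l < i)%N ->
    has_dirichlet_law (delta l i) (alpha_pair C p l i))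
  (law_last : has_dirichlet_law delta_last (alpha_last R n))
  (indep : mutually_independent (component_indices n)
    (components delta delta_last)).

Local Notation index_pair := ('I_n.+1 * 'I_n.+1)%type.

Let b (l : nat) : R := (C * theta p l ^+ 2 - 1) / 2.

Let ltn_pair (l i : 'I_n.+1) : (l < i)%N -> (l < n)%N.
Proof. by move=> li; rewrite (leq_trans li)// -ltnS. Qed.

Let C_gt0 : 0 < C.
Proof. by rewrite (le_lt_trans _ C_gt)// divr_ge0// ?sqr_ge0// mulr_ge0// sqr_ge0. Qed.

Let b_gt0 (l i : 'I_n.+1) : (l < i)%N -> 0 < b l.
Proof.
move=> li; rewrite divr_gt0// subr_gt0.
by apply: theta_sqr_gt => //; exact: ltn_pair li.
Qed.

Let alpha_pairE (l i k : 'I_n.+1) : (l < i)%N ->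
  alpha_pair C p l i k 0 = if (k == l) || (k == i) then b l else 0.
Proof.
move=> li; rewrite !mxE !eqxx !andbT /b.
have [kl|_] := eqVneq k l; last first.
  by case: eqP => _ /=; rewrite addr0 ?mulr1 ?mulr0.
have -> : (k == i) = false by apply/negbTE; rewrite kl neq_ltn li.
by rewrite /= add0r mulr1.
Qed.

Let phi (q : index_pair) (w : T) : R :=
  clipped_dev (tnth (delta q.1 q.2 w) q.2).

Let bounded_phi (q : index_pair) : bounded_measurable (phi q).
Proof.
split; last by exists 1 => w; exact: clipped_dev_le1.
exact: (measurableT_comp (@measurable_clipped_dev R)
  (measurableT_comp (measurable_tnth q.2) (measurable_funPT (delta q.1 q.2)))).
Qed.

Let phi1 (q : index_pair) : (q.1 < q.2)%N -> \int[P]_w phi q w = 0.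
Proof.
move=> lq; apply: (dirichlet_pair_moment1 lq (b_gt0 lq) _ (law_delta lq)) => k.
exact: alpha_pairE.
Qed.

(** The squared weight cancels against the variance; this is what the total parameter
    [C * theta p l ^+ 2 - 1] is designed for. *)
Let phi2 (q : index_pair) : (q.1 < q.2)%N ->
  theta p q.1 ^+ 2 * \int[P]_w (phi q w * phi q w) = (4 * C)^-1.
Proof.
move=> lq; have t0 := theta_gt0 p_gt0 p_mono (ltn_pair lq).
have -> : \int[P]_w (phi q w * phi q w) = (4 * (2 * b q.1 + 1))^-1.
  rewrite -(dirichlet_pair_moment2 lq (b_gt0 lq) _ (law_delta lq)); first by [].
  by move=> k; exact: alpha_pairE.
have -> : 2 * b q.1 + 1 = C * theta p q.1 ^+ 2 by rewrite /b; field.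
by field; rewrite !gt_eqF.
Qed.

Let phi3 (q : index_pair) : (q.1 < q.2)%N ->
  \int[P]_w (phi q w * phi q w * phi q w) = 0.
Proof.
move=> lq; rewrite -[RHS](dirichlet_pair_moment3 lq (b_gt0 lq) _ (law_delta lq)).
  by apply: eq_Rintegral => w _; rewrite !exprS expr0 mulr1 mulrA.
by move=> k; exact: alpha_pairE.
Qed.

Let indep_components (q r s : index_pair) (A B D : set (n.+1.-tuple R)) :
  (q.1 < q.2)%N -> (r.1 < r.2)%N -> (s.1 < s.2)%N -> s != q -> s != r ->
  measurable A -> measurable B -> measurable D ->
  (P ((delta q.1 q.2 @^-1` A `&` delta r.1 r.2 @^-1` B) `&`
      delta s.1 s.2 @^-1` D) =
   P (delta q.1 q.2 @^-1` A `&` delta r.1 r.2 @^-1` B) *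
   P (delta s.1 s.2 @^-1` D))%E.
Proof.
move=> lq lr ls sq sr mA mB mD.
pose J := [set Some q; Some r]%SET.
(* Since [q] and [r] may coincide, [F] intersects the two conditions: for q = r the single index
   carries both [A] and [B]. *)
pose F (o : option index_pair) :=
  (if o == Some q then A else setT) `&` (if o == Some r then B else setT).
pose G o := if o == Some s then D else F o.
have mF o : measurable (F o) by apply: measurableI; case: ifP.
have mG o : measurable (G o) by rewrite /G; case: ifP.
have subJ : J \subset component_indices n.
  by apply/fintype.subsetP => o; rewrite !inE => /orP[]/eqP ->.
have subJs : (Some s |: J)%SET \subset component_indices n.
  apply/fintype.subsetP => o; rewrite in_setU1 => /predU1P[->|]; first by rewrite inE.
  exact: (fintype.subsetP subJ).
have sJ : Some s \notin J by rewrite !inE !(inj_eq Some_inj) negb_or sq sr.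
have := indep subJs mG; rewrite big_setU1//=.
have -> : G (Some s) = D by rewrite /G eqxx.
have -> : (\prod_(j in J) P (components delta delta_last j @^-1` G j) =
    \prod_(j in J) P (components delta delta_last j @^-1` F j))%E.
  apply: eq_bigr => o oJ; rewrite /G ifF//; apply/negbTE.
  by apply: contraNneq sJ => <-.
rewrite -(indep subJ mF).
have -> : \bigcap_(j in [set` J]) (components delta delta_last j @^-1` F j) =
    delta q.1 q.2 @^-1` A `&` delta r.1 r.2 @^-1` B.
  apply/seteqP; split => [w Fw|w [Aw Bw] o].
    split.
      have /= := Fw (Some q); rewrite !inE eqxx => /(_ isT)[].
      by rewrite /= /F eqxx.
    have /= := Fw (Some r); rewrite !inE eqxx orbT => /(_ isT)[_].
    by rewrite /= eqxx.
  rewrite /= !inE /F => _; split; case: eqP => // -> //=.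
have -> : \bigcap_(j in [set` (Some s |: J)%SET])
      (components delta delta_last j @^-1` G j) =
    delta q.1 q.2 @^-1` A `&` delta r.1 r.2 @^-1` B `&` delta s.1 s.2 @^-1` D.
  apply/seteqP; split => [w Gw|w [[Aw Bw] Dw] o].
    split; [split|].
    - have /= := Gw (Some q); rewrite !inE eqxx orbT => /(_ isT).
      by rewrite /G (inj_eq Some_inj) eq_sym (negbTE sq) => -[]; rewrite eqxx.
    - have /= := Gw (Some r); rewrite !inE eqxx !orbT => /(_ isT).
      by rewrite /G (inj_eq Some_inj) eq_sym (negbTE sr) => -[_]; rewrite eqxx.
    - have /= := Gw (Some s); rewrite !inE eqxx => /(_ isT).
      by rewrite /G eqxx.
  rewrite /= !inE /G /F => _; case: eqP => [->//|_].
  by split; case: eqP => // -> //=.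
by rewrite muleC.
Qed.

(** The exponents let one statement serve both covariances (k = 0) and third moments (j = k = 1). *)
Let phi_indep (q r s : index_pair) (j k : nat) :
  (q.1 < q.2)%N -> (r.1 < r.2)%N -> (s.1 < s.2)%N -> s != q -> s != r ->
  \int[P]_w (phi q w ^+ j * phi r w ^+ k * phi s w) = 0.
Proof.
move=> lq lr ls sq sr.
have mdev (i : 'I_n.+1) m : measurable_fun setT
    (fun x : n.+1.-tuple R => clipped_dev (tnth x i) ^+ m).
  apply: measurable_funX.
  exact: (measurableT_comp (@measurable_clipped_dev R) (measurable_tnth i)).
have bdev (i : 'I_n.+1) m : exists M, forall x : n.+1.-tuple R,
    `|clipped_dev (tnth x i) ^+ m| <= M.
  by exists 1 => x; rewrite normrX exprn_ile1// clipped_dev_le1.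
apply: (@independent_Rintegral_eq0 _ _ _ P _ _ (delta q.1 q.2) (delta r.1 r.2)
  (delta s.1 s.2) (fun x => clipped_dev (tnth x q.2) ^+ j)
  (fun x => clipped_dev (tnth x r.2) ^+ k)
  (fun x => clipped_dev (tnth x s.2) ^+ 1)) => //.
- by move=> A B D; exact: indep_components.
- exact: phi1.
Qed.

Let phi_cov (q r : index_pair) : (q.1 < q.2)%N -> (r.1 < r.2)%N -> q != r ->
  \int[P]_w (phi q w * phi r w) = 0.
Proof.
move=> lq lr qr; have rq : r != q by rewrite eq_sym.
rewrite -[RHS](@phi_indep q q r 1 0)//.
by apply: eq_Rintegral => w _; rewrite mulr1.
Qed.

(** Among three indices either all agree, and the third moment of one edge is 0, or one occurs
    exactly once and its centered factor splits off. *)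
Let phi_third (q r s : index_pair) :
  (q.1 < q.2)%N -> (r.1 < r.2)%N -> (s.1 < s.2)%N ->
  \int[P]_w (phi q w * phi r w * phi s w) = 0.
Proof.
move=> lq lr ls.
have [sq|sq] := eqVneq s q; last first.
  have [sr|sr] := eqVneq s r; last exact: (@phi_indep q r s 1 1).
  rewrite sr in sq *; rewrite -[RHS](@phi_indep r r q 1 1)// 1?eq_sym//.
  by apply: eq_Rintegral => w _; rewrite -mulrA mulrC.
have [qr|qr] := eqVneq q r; first by rewrite sq -qr; exact: phi3.
rewrite sq -[RHS](@phi_indep q q r 1 1)// 1?eq_sym//.
by apply: eq_Rintegral => w _; rewrite mulrAC.
Qed.

Let coef (q : index_pair) (k : 'I_n.+1) : R :=
  theta p q.1 * ((k == q.2)%:R - (k == q.1)%:R).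

(** A version of [(X w - p) k 0] that agrees with it almost surely and, unlike it, is bounded at
    every point. *)
Let dev (k : 'I_n.+1) (w : T) : R :=
  \sum_(q : index_pair | (q.1 < q.2)%N) coef q k * phi q w.

Let bounded_dev k : bounded_measurable (dev k).
Proof.
apply: bounded_measurable_sum => q _; apply: bounded_measurableM => //.
exact: bounded_measurable_cst.
Qed.

Let Rintegral_dev k : \int[P]_w dev k w = 0.
Proof.
rewrite bounded_Rintegral_sum => [|q _].
  by rewrite big1// => q lq; rewrite bounded_RintegralZl// phi1// mulr0.
by apply: bounded_measurableM => //; exact: bounded_measurable_cst.
Qed.

Let Rintegral_dev2 j k : \int[P]_w (dev j w * dev k w) =
  (4 * C)^-1 * (n.+1%:R * (j == k)%:R - 1).
Proof.
under eq_Rintegral do rewrite mulr_suml.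
have bc := @bounded_measurable_cst _ T R; have bM := @bounded_measurableM _ T R.
rewrite bounded_Rintegral_sum => [|q _]; last by apply: (bM) => //; apply: bM.
rewrite -sum_pair_graph_laplacian pair_big_dep/= mulr_sumr.
apply: eq_bigr => q lq.
under eq_Rintegral do rewrite -mulrA.
rewrite bounded_RintegralZl; last exact: bM.
under eq_Rintegral do rewrite mulr_sumr.
rewrite bounded_Rintegral_sum => [|r _]; last by apply: (bM) => //; apply: bM.
rewrite (bigD1 q)//= big1 ?addr0 => [|r /andP[lr rq]].
  under eq_Rintegral do rewrite mulrCA.
  rewrite bounded_RintegralZl; last exact: bM.
  by rewrite -(phi2 lq) /coef; ring.
under eq_Rintegral do rewrite mulrCA.
rewrite bounded_RintegralZl; last exact: bM.
by rewrite phi_cov ?mulr0// eq_sym.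
Qed.

Let Rintegral_dev3 i j k : \int[P]_w (dev i w * dev j w * dev k w) = 0.
Proof.
have bc := @bounded_measurable_cst _ T R; have bM := @bounded_measurableM _ T R.
have bcp a q k' : bounded_measurable (fun w => a * (coef q k' * phi q w)).
  by apply: (bM) => //; apply: bM.
transitivity (\int[P]_w (\sum_(q : index_pair | (q.1 < q.2)%N)
  \sum_(r : index_pair | (r.1 < r.2)%N)
  \sum_(s : index_pair | (s.1 < s.2)%N)
    (coef q i * coef r j * coef s k) * (phi q w * phi r w * phi s w))).
  apply: eq_Rintegral => w _; rewrite /dev -mulrA mulr_suml; apply: eq_bigr => q _.
  rewrite mulr_suml mulr_sumr; apply: eq_bigr => r _.
  by rewrite 2!mulr_sumr; apply: eq_bigr => s _; ring.
have b3 q r s c : bounded_measurable (fun w => c * (phi q w * phi r w * phi s w)).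
  by apply: (bM) => //; apply: (bM) => //; apply: bM.
rewrite bounded_Rintegral_sum => [|q _]; last first.
  by apply: bounded_measurable_sum => r _; exact: bounded_measurable_sum.
rewrite big1// => q lq; rewrite bounded_Rintegral_sum => [|r _]; last first.
  exact: bounded_measurable_sum.
rewrite big1// => r lr; rewrite bounded_Rintegral_sum// big1// => s ls.
rewrite bounded_RintegralZl ?phi_third ?mulr0//.
by apply: (bM) => //; apply: bM.
Qed.

Local Notation X := (delta_star p delta delta_last).

Let delta_starE w k : X w k 0 =
  \sum_(l < n.+1) \sum_(i < n.+1 | (l < i)%N) theta p l * tnth (delta l i w) k
  + theta_last p * tnth (delta_last w) k.
Proof.
rewrite /delta_star !mxE summxE; congr (_ + _); apply: eq_bigr => l _.
by rewrite summxE; apply: eq_bigr => i _; rewrite !mxE.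
Qed.

Let measurable_delta_star k : measurable_fun setT (fun w => (X w - p) k 0).
Proof.
under eq_fun do rewrite mxE [X in _ + X]mxE delta_starE.
have mtnth (Y : {RV P >-> n.+1.-tuple R}) c :
    measurable_fun setT (fun w => c * tnth (Y w) k).
  apply: measurable_funM => //.
  exact: (measurableT_comp (measurable_tnth k) (measurable_funPT Y)).
apply: measurable_funB => //; apply: measurable_funD => //.
apply: measurable_sum => l; under eq_fun do rewrite big_mkcond/=.
by apply: measurable_sum => i; case: (l < i)%N.
Qed.

Let delta_last_ae :
  {ae P, forall w, delta_last w = tuplev (delta_mx ord_max 0)}.
Proof.
have aek (k : 'I_n.+1) : {ae P, forall w,
    tnth (delta_last w) k = tnth (tuplev (delta_mx ord_max 0)) k}.
  pose B := (fun x : n.+1.-tuple R => tnth x k) @^-1`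
    (~` [set tnth (tuplev (delta_mx ord_max 0)) k]).
  have mB : measurable B.
    rewrite -[B]setTI; apply: measurable_tnth => //.
    by apply: measurableC; exact: measurable_set1.
  exists (delta_last @^-1` B); split.
  - by rewrite -[_ @^-1` _]setTI; exact: measurable_funPT.
  - rewrite [LHS](law_last mB) dirichlet_point diracE memNset//.
    by move=> /(_ erefl).
  - by move=> w /=.
have aeall : {ae P, forall w, forall k : 'I_n.+1,
    tnth (delta_last w) k = tnth (tuplev (delta_mx ord_max 0)) k}.
  exact: filter_forall.
by apply: filterS aeall => w; exact: eq_from_tnth.
Qed.

Let dev_ae : {ae P, forall w, forall k, (X w - p) k 0 = dev k w}.
Proof.
have aeq (q : index_pair) : {ae P, forall w, (q.1 < q.2)%N ->
    delta q.1 q.2 w = segment_point q.1 q.2 (2^-1 + phi q w)}.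
  have [lq|lq] := boolP (q.1 < q.2)%N; last by apply: aeW.
  have := dirichlet_pair_ae lq (b_gt0 lq) (fun k => alpha_pairE k lq)
    (law_delta lq).
  by apply: filterS => w.
have aeall : {ae P, forall w, forall q : index_pair, (q.1 < q.2)%N ->
    delta q.1 q.2 w = segment_point q.1 q.2 (2^-1 + phi q w)}.
  exact: filter_forall.
apply: filterS2 delta_last_ae aeall => w lastw eqw k.
(* Expanding p by [mixture_mean] matches it with the mixture edge by edge: the midpoints cancel, the
   [theta_last] terms cancel, and [coef] times [phi] remains. *)
rewrite mxE [X in _ + X]mxE delta_starE -[in X in _ - X](mixture_mean p k).
rewrite lastw tnth_mktuple mxE eqxx andbT opprD addrACA subrr addr0.
rewrite /dev -(pair_big_dep xpredT (fun l i : 'I_n.+1 => (l < i)%N)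
  (fun l i => coef (l, i) k * phi (l, i) w))/= -sumrB.
apply: eq_bigr => l _; rewrite -sumrB; apply: eq_bigr => i li.
rewrite (eqw (l, i))//= tnth_mktuple /coef/=.
have [->|_] := eqVneq k l; last first.
  by case: eqP => _ /=; field.
have -> : (l == i) = false by apply/negbTE; rewrite neq_ltn li.
by rewrite /= ?eqxx /=; field.
Qed.

Let expectation_dev (F G : T -> R) : measurable_fun setT F ->
  bounded_measurable G -> {ae P, forall w, F w = G w} ->
  'E_P[F]%E = (\int[P]_w G w)%:E.
Proof.
move=> mF bG FG; rewrite unlock -bounded_EFin_Rintegral//.
apply: ae_eq_integral => //.
- exact/measurable_EFinP.
- by apply/measurable_EFinP; case: bG.
- by apply: filterS FG => w Fw _; rewrite Fw.
Qed.

Variable gamma : R.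

Let expectation_score k : 'E_P[fun w => (score gamma p (X w) k 0)%R]%E = 0%E.
Proof.
rewrite (@expectation_dev _ (fun w => gamma * dev k w)).
- by rewrite bounded_RintegralZl// Rintegral_dev mulr0.
- under eq_fun do rewrite mxE; exact: measurable_funM.
- by apply: bounded_measurableM => //; exact: bounded_measurable_cst.
- by apply: filterS dev_ae => w devw; rewrite mxE devw.
Qed.

Let expectation_dev_score j k :
  'E_P[fun w => (((X w - p) *m (score gamma p (X w))^T) j k)%R]%E =
  (gamma / (4 * C) * (n.+1%:R * (j == k)%:R - 1))%:E.
Proof.
have entry w : ((X w - p) *m (score gamma p (X w))^T) j k =
    gamma * ((X w - p) j 0 * (X w - p) k 0).
  rewrite mxE big_ord1 [X in _ * X]mxE [X in _ * X]mxE; ring.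
under [X in expectation _ X]eq_fun do rewrite entry.
rewrite (@expectation_dev _ (fun w => gamma * (dev j w * dev k w))).
- rewrite bounded_RintegralZl; first by rewrite Rintegral_dev2 mulrA.
  exact: bounded_measurableM.
- by apply: measurable_funM => //; exact: measurable_funM.
- apply: bounded_measurableM; first exact: bounded_measurable_cst.
  exact: bounded_measurableM.
- by apply: filterS dev_ae => w devw; rewrite !devw.
Qed.

Let expectation_dev2_score i j k :
  'E_P[fun w => ((X w - p) i 0 * (X w - p) j 0
                 * score gamma p (X w) k 0)%R]%E = 0%E.
Proof.
rewrite (@expectation_dev _ (fun w => gamma * (dev i w * dev j w * dev k w))).
- rewrite bounded_RintegralZl; first by rewrite Rintegral_dev3 mulr0.
  by apply: bounded_measurableM => //; exact: bounded_measurableM.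
- apply: measurable_funM; first exact: measurable_funM.
  by under eq_fun do rewrite mxE; exact: measurable_funM.
- apply: bounded_measurableM; first exact: bounded_measurable_cst.
  by apply: bounded_measurableM => //; exact: bounded_measurableM.
- by apply: filterS dev_ae => w devw; rewrite [X in _ * X]mxE !devw; ring.
Qed.

Lemma dirichlet_mixture_moments :
  [/\ forall k, 'E_P[fun w => (score gamma p (X w) k 0)%R]%E = 0%E,
      forall j k, 'E_P[fun w => (((X w - p) *m (score gamma p (X w))^T) j k)%R]%E =
        (gamma / (4 * C) * (n.+1%:R * (j == k)%:R - 1))%:E
    & forall i j k,
      'E_P[fun w => ((X w - p) i 0 * (X w - p) j 0
                     * score gamma p (X w) k 0)%R]%E = 0%E].
Proof. by split. Qed.

End dirichlet_mixture.

Theorem theorem5 (R : realType) (d : measure_display) (T : measurableType d)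
    (P : probability T R) (n : nat) (hn : (2 <= n.+1)%N)
    (p : 'cV[R]_n.+1) (hp_pos : 0 < p ord0 0)
    (hp_mono : forall i j : 'I_n.+1, (i <= j)%N -> p i 0 <= p j 0)
    (hp_sum : \sum_i p i 0 = 1)
    (C : R) (hC : n%:R ^+ 2 / (4 * p ord0 0 ^+ 2) < C)
    (delta : 'I_n.+1 -> 'I_n.+1 -> {RV P >-> n.+1.-tuple R})
    (delta_last : {RV P >-> n.+1.-tuple R})
    (hdelta : forall l i : 'I_n.+1, (l < i)%N ->
      has_dirichlet_law (delta l i) (alpha_pair C p l i))
    (hdelta_last : has_dirichlet_law delta_last (alpha_last R n))
    (hindep : mutually_independent (component_indices n)
                (components delta delta_last)) :
  let gamma := 4 * C / n.+1%:R in
  let X := delta_star p delta delta_last in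
  [/\ expectation_mx P (fun w => score gamma p (X w)) = EFin_mx 0,
      exists lambda : R,
        expectation_mx P (fun w => (X w - p) *m (score gamma p (X w))^T) =
        EFin_mx (1%:M - lambda *: (const_mx 1 *m (const_mx 1 : 'cV[R]_n.+1)^T))
    & forall i j k : 'I_n.+1,
        'E_P[fun w => ((X w - p) i 0 * (X w - p) j 0
                       * score gamma p (X w) k 0)%R]%E = 0%E].
Proof.
move=> gamma X.
have n0 : (n.+1%:R : R) != 0 by rewrite pnatr_eq0.
have C0 : C != 0.
  by rewrite gt_eqF// (le_lt_trans _ hC)// divr_ge0// ?sqr_ge0// mulr_ge0// sqr_ge0.
have [mean cov third] := dirichlet_mixture_moments hp_pos hp_mono hC hdelta
  hdelta_last hindep gamma.
split => //.
  by apply/matrixP => k j; rewrite !mxE ord1 mean.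
(* The choice of [gamma] makes [gamma / (4 * C)] the inverse of the dimension, which normalizes the
   Laplacian to diagonal part I and leaves this value for lambda. *)
exists n.+1%:R^-1; apply/matrixP => j k; rewrite [LHS]mxE cov !mxE big_ord1 !mxE.
by congr EFin; rewrite /gamma; field; rewrite nat1r n0 C0.
Qed.
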